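(* When the input graph is the complete graph $K_n$, both \textsc{Min Edge Deletion Bounded-Density} and \textsc{Min Density Edge Deletion} can be solved in time $O(n^2)$.
   Context: All graphs are finite, simple and undirected. The density of a graph $H$ is $\rho(H)=|E(H)|/|V(H)|$ (the empty graph has density $0$), and $\rho^*(G)=\max_{H\subseteq G}\rho(H)$. For $F\subseteq E(G)$, $G-F$ is the graph obtained by removing the edges in $F$. \textsc{Min Edge Deletion Bounded-Density}: given a graph $G$ and a rational $\tau_\rho\ge 0$, compute a minimum-size set $F\subseteq E(G)$ with $\rho^*(G-F)\le\tau_\rho$. \textsc{Min Density Edge Deletion}: given a graph $G$ and an integer $k\ge 0$, compute a set $F\subseteq E(G)$ with $|F|\le k$ minimizing $\rho^*(G-F)$ (equivalently, the minimum $\tau_\rho$ for which some $F$ with $|F|\le k$ satisfies $\rho^*(G-F)\le\tau_\rho$). *)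

(* Defs.v *)
From HB Require Import structures.
From mathcomp Require Import all_boot all_order all_algebra.

Set Implicit Arguments.
Unset Strict Implicit.
Unset Printing Implicit Defensive.

Import Order.TTheory GRing.Theory Num.Theory.

Section Graphs.
Variable V : finType.

Definition is_graph (H : {set V} * {set {set V}}) : bool :=
  [forall e in H.2, (#|e| == 2) && (e \subset H.1)].

(* Finite simple undirected graphs with vertices in V; the vertex set may be a
   proper subset of V, so that subgraphs of a graph have the same type. *)
Record sgraph := SGraph {
  gpair : {set V} * {set {set V}};
  gpairP : is_graph gpair
}.

HB.instance Definition _ := [isSub for gpair].
HB.instance Definition _ := [Finite of sgraph by <:].

Definition vset (G : sgraph) : {set V} := (gpair G).1.
Definition eset (G : sgraph) : {set {set V}} := (gpair G).2.

Definition subgraph (H G : sgraph) : bool :=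
  (vset H \subset vset G) && (eset H \subset eset G).

(* In rat, 0 / 0 = 0, so the empty graph has density 0. *)
Definition density (H : sgraph) : rat := (#|eset H|%:R / #|vset H|%:R)%R.

(* Densities are nonnegative, so the default value 0 does not affect the
   maximum. *)
Definition max_density (G : sgraph) : rat :=
  \big[Num.max/0%R]_(H : sgraph | subgraph H G) density H.

Lemma del_edges_subproof (G : sgraph) (F : {set {set V}}) :
  is_graph (vset G, eset G :\: F).
Proof.
apply/forall_inP => e /setDP[eG _].
by have /forall_inP/(_ e eG) := gpairP G.
Qed.

Definition del_edges (G : sgraph) (F : {set {set V}}) : sgraph :=
  SGraph (del_edges_subproof G F).

Lemma complete_subproof : is_graph ([set: V], [set e : {set V} | #|e| == 2]).
Proof. by apply/forall_inP => e; rewrite inE subsetT andbT. Qed.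

Definition complete_graph : sgraph := SGraph complete_subproof.

Definition min_edge_deletion_bounded_density
    (G : sgraph) (tau : rat) (F : {set {set V}}) : Prop :=
  [/\ F \subset eset G,
      (max_density (del_edges G F) <= tau)%R
    & forall F' : {set {set V}}, F' \subset eset G ->
        (max_density (del_edges G F') <= tau)%R -> #|F| <= #|F'| ].

Definition min_density_edge_deletion
    (G : sgraph) (k : nat) (F : {set {set V}}) : Prop :=
  [/\ F \subset eset G,
      #|F| <= k
    & forall F' : {set {set V}}, F' \subset eset G -> #|F'| <= k ->
        (max_density (del_edges G F) <= max_density (del_edges G F'))%R ].

End Graphs.

(* The random access machine of Cook and Reckhow (1973) with the uniform cost
   measure: registers X_0, X_1, ... indexed by nat, a read-only input sequence
   and a write-only output sequence; every executed instruction takes one unit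
   of time.  Registers hold natural numbers and subtraction is truncated.
   There is deliberately no unit-cost multiplication or division. *)
Inductive instr : Type :=
| Iconst (i c : nat)      (* X_i <- c *)
| Iadd (i j k : nat)      (* X_i <- X_j + X_k *)
| Isub (i j k : nat)      (* X_i <- X_j - X_k *)
| Iload (i j : nat)       (* X_i <- X_(X_j) *)
| Istore (i j : nat)      (* X_(X_i) <- X_j *)
| IjumpPos (j l : nat)    (* go to instruction l if X_j > 0 *)
| Iread (i : nat)         (* X_i <- next input item, 0 if there is none *)
| Iprint (i : nat).       (* append X_i to the output *)

Definition program := seq instr.

Record state := State {
  pc : nat;
  reg : nat -> nat;
  input : seq nat;
  output : seq nat
}.

Definition upd (X : nat -> nat) (i v : nat) : nat -> nat :=
  fun j => if j == i then v else X j.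

Definition exec (c : instr) (s : state) : state :=
  let: State p X inp out := s in
  match c with
  | Iconst i c => State p.+1 (upd X i c) inp out
  | Iadd i j k => State p.+1 (upd X i (X j + X k)) inp out
  | Isub i j k => State p.+1 (upd X i (X j - X k)) inp out
  | Iload i j => State p.+1 (upd X i (X (X j))) inp out
  | Istore i j => State p.+1 (upd X (X i) (X j)) inp out
  | IjumpPos j l => State (if 0 < X j then l else p.+1) X inp out
  | Iread i => State p.+1 (upd X i (head 0 inp)) (behead inp) out
  | Iprint i => State p.+1 X inp (rcons out (X i))
  end.

(* The machine halts when the program counter leaves the program; halted
   states are fixed points of step. *)
Definition halted (P : program) (s : state) : bool := size P <= pc s.

Definition step (P : program) (s : state) : state :=
  if onth P (pc s) is Some c then exec c s else s.

Definition init (w : seq nat) : state := State 0 (fun=> 0) w [::].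

(* On input w, P halts after at most t steps and its output is w'. *)
Definition computes_within (P : program) (t : nat) (w w' : seq nat) : Prop :=
  halted P (iter t (step P) (init w)) /\
  output (iter t (step P) (init w)) = w'.

Definition bigO (T f : nat -> nat) : Prop :=
  exists C n0 : nat, forall n, n0 <= n -> T n <= C * f n.

(* A graph on the vertex set {0, ..., n-1} is given by n and its adjacency
   matrix in row-major order. *)
Definition adjacency_word (n : nat) (G : sgraph 'I_n) : seq nat :=
  [seq nat_of_bool ([set u; v] \in eset G) | u <- enum 'I_n, v <- enum 'I_n].

(* An instance is n, followed by the parameter, followed by the matrix. *)
Definition instance_word (n : nat) (G : sgraph 'I_n) (param : seq nat) :
  seq nat := n :: param ++ adjacency_word G.

(* Numerator and denominator in lowest terms; only used for 0 <= tau. *)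
Definition rat_word (tau : rat) : seq nat :=
  [:: absz (numq tau); absz (denq tau)].

(* w lists each edge of F exactly once, in any order, each edge being given by
   its two endpoints. *)
Definition lists_edges (n : nat) (w : seq nat) (F : {set {set 'I_n}}) : Prop :=
  exists s : seq ('I_n * 'I_n),
    w = flatten [seq [:: nat_of_ord e.1; nat_of_ord e.2] | e <- s] /\
    perm_eq [seq [set e.1; e.2] | e <- s] (enum F).

(* The edge-set problem Sol (a relation between a graph on {0, ..., n-1}, a
   parameter and a solution), restricted to the inputs satisfying Dom, is
   solved by a single program in time O(f n), uniformly in the parameter. *)
Definition solvable_in_time (A : Type) (enc : A -> seq nat)
    (Dom : forall n, sgraph 'I_n -> A -> Prop)
    (Sol : forall n, sgraph 'I_n -> A -> {set {set 'I_n}} -> Prop)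
    (f : nat -> nat) : Prop :=
  exists (P : program) (T : nat -> nat), bigO T f /\
    forall (n : nat) (G : sgraph 'I_n) (a : A), Dom n G a ->
      exists (w : seq nat) (F : {set {set 'I_n}}),
        [/\ computes_within P (T n) (instance_word G (enc a)) w,
            lists_edges w F
          & Sol n G a F].

(* Main.v *)
Require Import Defs.
From HB Require Import structures.
From mathcomp Require Import all_boot all_order all_algebra.
From mathcomp Require Import zify.

Set Implicit Arguments.
Unset Strict Implicit.
Unset Printing Implicit Defensive.

Import Order.TTheory GRing.Theory Num.Theory.

(** A graph has maximum density at most p / q as soon as the unit weight of
    each edge can be split between its endpoints so that every vertex receives
    at most p / q.  For q <= p + 1, let vertex i of the cyclically ordered
    vertex set {0, ..., n-1} keep its edges to the next
    L_i = floor((i+1)p/q) - floor(ip/q) vertices.  If i receives the weight of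
    these edges, its load differs from p / q by a telescoping error smaller
    than 1, which is repaired by moving a fraction of the weight of each edge
    {i, i+1} from i to i+1.  Hence floor(np/q) edges are kept, and no graph of
    density at most p / q on n vertices has more.  The arcs overlap only when
    p / q > (n-2)/2; proper vertex subsets are then harmless, and any choice of
    the deleted edges is optimal.  A maximum density below 1 is that of a tree,
    (K-1)/K for some K, so a bound p / q < 1 can first be rounded to this form,
    for which q <= p + 1. *)

(** * Fragments of programs and their running time *)

(* Code as a function of the address at which it is placed, since jump targets
   are absolute. *)
Definition frag := nat -> seq instr.

Definition assertion := (nat -> nat) -> seq nat -> seq nat -> Prop.

(** Hoare triples for total correctness with time bound t. Quantifying over the surrounding code
    [pre] and [post] is what makes fragments composable. *)
Definition triple (f : frag) (t : nat) (P Q : assertion) : Prop :=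
  forall pre post X inp out, P X inp out ->
  exists t' X' inp' out',
    [/\ t' <= t,
        iter t' (step (pre ++ f (size pre) ++ post))
          (State (size pre) X inp out)
          = State (size pre + size (f (size pre))) X' inp' out'
      & Q X' inp' out'].

Definition is_jump (c : instr) : bool :=
  if c is IjumpPos _ _ then true else false.

Definition block (l : seq instr) : frag := fun=> l.

Definition seqf (f g : frag) : frag :=
  fun o => f o ++ g (o + size (f o)).

Definition unless_pos (r : nat) (f : frag) : frag :=
  fun o => IjumpPos r (o.+1 + size (f o.+1)) :: f o.+1.

(* The body runs at least once, and has to decrement its counter r itself. *)
Definition loop (r : nat) (f : frag) : frag :=
  fun o => rcons (f o) (IjumpPos r o).

(** The weakest precondition of jump-free code, by symbolic execution; the starting address 0 is
    arbitrary, since such code only increments it. *)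
Definition block_post (l : seq instr) (Q : assertion) : assertion :=
  fun X inp out =>
    let s := foldl (fun s c => exec c s) (State 0 X inp out) l in
    Q (reg s) (input s) (output s).

Lemma onth_cat_size (T : Type) (s1 s2 : seq T) i :
  onth (s1 ++ s2) (size s1 + i) = onth s2 i.
Proof. by rewrite onth_cat ltnNge leq_addr /= addKn. Qed.

Local Arguments exec : simpl never.

Lemma exec_pc c p X inp out : ~~ is_jump c ->
  let s := exec c (State 0 X inp out) in
  exec c (State p X inp out) = State p.+1 (reg s) (input s) (output s).
Proof. by case: c. Qed.

Lemma foldl_exec_pc l p X inp out : all (predC is_jump) l ->
  let s := foldl (fun s c => exec c s) (State 0 X inp out) l in
  foldl (fun s c => exec c s) (State p X inp out) l =
    State (p + size l) (reg s) (input s) (output s).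
Proof.
elim: l p X inp out => [|c l IH] p X inp out /=; first by rewrite addn0.
case/andP=> jc jl; rewrite (exec_pc p) // (exec_pc 0) // IH // [in RHS]IH //=.
by rewrite addnS.
Qed.

Lemma iter_step_block pre l post X inp out : all (predC is_jump) l ->
  iter (size l) (step (pre ++ l ++ post)) (State (size pre) X inp out) =
  foldl (fun s c => exec c s) (State (size pre) X inp out) l.
Proof.
elim: l pre X inp out => [|c l IH] pre X inp out //= /andP[jc jl].
rewrite -iterS iterSr {2}/step /= -[X in onth _ X]addn0 onth_cat_size /=.
rewrite exec_pc //= -cat_rcons -[in State (size pre).+1](size_rcons pre c).
by rewrite IH.
Qed.

Lemma triple_block l (P Q : assertion) : all (predC is_jump) l ->
  (forall X inp out, P X inp out -> block_post l Q X inp out) ->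
  triple (block l) (size l) P Q.
Proof.
move=> jl PQ pre post X inp out HP; rewrite /block.
pose s := foldl (fun s c => exec c s) (State 0 X inp out) l.
exists (size l), (reg s), (input s), (output s); split=> //.
  by rewrite iter_step_block // foldl_exec_pc.
exact: PQ.
Qed.

Lemma triple_seq f g t1 t2 (P Q S : assertion) :
  triple f t1 P Q -> triple g t2 Q S -> triple (seqf f g) (t1 + t2) P S.
Proof.
move=> Hf Hg pre post X inp out HP; rewrite /seqf -catA.
have [u1 [X1 [i1 [o1 [le1 run1 Q1]]]]] :=
  Hf pre (g (size pre + size (f (size pre))) ++ post) _ _ _ HP.
have [u2 [X2 [i2 [o2 [le2 run2 Q2]]]]] :=
  Hg (pre ++ f (size pre)) post _ _ _ Q1.
exists (u2 + u1), X2, i2, o2; split=> //; first by rewrite addnC leq_add.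
rewrite iterD run1; move: run2; rewrite !size_cat -!catA => ->.
by rewrite addnA.
Qed.

Lemma triple_conseq f t t' (P P' Q Q' : assertion) :
  triple f t P' Q' -> t <= t' ->
  (forall X inp out, P X inp out -> P' X inp out) ->
  (forall X inp out, Q' X inp out -> Q X inp out) ->
  triple f t' P Q.
Proof.
move=> H le_t PP QQ pre post X inp out /PP HP.
have [u [X1 [i1 [o1 [le1 run1 Q1]]]]] := H pre post _ _ _ HP.
by exists u, X1, i1, o1; split; [exact: leq_trans le_t| |exact: QQ].
Qed.

Lemma triple_time f t t' (P Q : assertion) :
  t <= t' -> triple f t P Q -> triple f t' P Q.
Proof. by move=> le_t H; apply: triple_conseq H le_t _ _. Qed.

Lemma triple_unless_pos r f t (P Q : assertion) :
  triple f t (fun X inp out => P X inp out /\ X r = 0) Q ->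
  (forall X inp out, P X inp out -> 0 < X r -> Q X inp out) ->
  triple (unless_pos r f) t.+1 P Q.
Proof.
move=> Hf Hskip pre post X inp out HP; rewrite /unless_pos.
set c := IjumpPos _ _; set n := size pre.
have step1 : step (pre ++ (c :: f n.+1) ++ post) (State n X inp out) =
    State (if 0 < X r then n.+1 + size (f n.+1) else n.+1) X inp out.
  by rewrite /step /= /n -[X in onth _ X]addn0 onth_cat_size.
case: (posnP (X r)) => [Xr0|Xr_gt0].
  have [u [X1 [i1 [o1 [le1 run1 Q1]]]]] :=
    Hf (rcons pre c) post _ _ _ (conj HP Xr0).
  exists u.+1, X1, i1, o1; split=> //.
  rewrite iterSr step1 Xr0 /=; move: run1.
  by rewrite size_rcons cat_rcons -/n addSnnS => ->.
exists 1, X, inp, out; split=> //; last exact: Hskip.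
by rewrite /= step1 Xr_gt0 addSnnS.
Qed.

Lemma triple_loop r f N t (Inv : nat -> assertion) :
  0 < N ->
  (forall k X inp out, Inv k X inp out -> X r = N - k) ->
  (forall k, k < N -> triple f t (Inv k) (Inv k.+1)) ->
  triple (loop r f) (N * t.+1) (Inv 0) (Inv N).
Proof.
move=> N_gt0 Ir Hf pre post X inp out HI; rewrite /loop.
set n := size pre; set c := IjumpPos _ _; set prog := pre ++ _.
have progE : prog = pre ++ f n ++ (c :: post) by rewrite /prog -cats1 -catA.
have jump Y i o : step prog (State (n + size (f n)) Y i o) =
    State (if 0 < Y r then n else (n + size (f n)).+1) Y i o.
  rewrite progE /step /= catA -size_cat -[X in onth _ X]addn0.
  by rewrite onth_cat_size.
(* Induction on the number d+1 of rounds still to run; by [Ir] the jump falls through exactly after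
   round N. *)
have : forall d k X inp out, d.+1 = N - k -> Inv k X inp out ->
  exists t' X' inp' out', [/\ t' <= d.+1 * t.+1,
    iter t' (step prog) (State n X inp out)
      = State (n + size (f n)).+1 X' inp' out' & Inv N X' inp' out'].
  move=> {X inp out HI}; elim=> [|d IH] k X inp out Ek HI.
    have ltk : k < N by lia.
    have [u [X1 [i1 [o1 [le1 run1 Q1]]]]] := Hf k ltk pre (c :: post) _ _ _ HI.
    exists u.+1, X1, i1, o1; split; first by lia.
      rewrite iterS; rewrite -progE in run1; rewrite run1 jump (Ir _ _ _ _ Q1).
      by have -> : N - k.+1 = 0 by lia.
    by have <- : k.+1 = N by lia.
  have ltk : k < N by lia.
  have [u [X1 [i1 [o1 [le1 run1 Q1]]]]] := Hf k ltk pre (c :: post) _ _ _ HI.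
  have [|u2 [X2 [i2 [o2 [le2 run2 Q2]]]]] := IH k.+1 _ _ _ _ Q1; first by lia.
  exists (u2 + u.+1), X2, i2, o2; split=> //; first by lia.
  rewrite iterD iterS; rewrite -progE in run1.
  rewrite run1 jump (Ir _ _ _ _ Q1).
  by have -> : 0 < N - k.+1 by lia.
move=> /(_ N.-1 0 X inp out); rewrite subn0 prednK // => /(_ erefl HI).
by rewrite size_rcons addnS.
Qed.

Lemma iter_step_halted P s k : halted P s -> iter k (step P) s = s.
Proof.
by move=> hs; elim: k => //= k ->; rewrite /step onth_default.
Qed.

Lemma triple_computes f t (P Q : assertion) w :
  triple f t P Q -> P (fun=> 0) w [::] ->
  exists X inp out, computes_within (f 0) t w out /\ Q X inp out.
Proof.
move=> Hf HP; have [u [X [i [o [le_u run HQ]]]]] := Hf [::] [::] _ _ _ HP.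
exists X, i, o; split=> //; rewrite /computes_within.
rewrite /= cats0 add0n in run.
have h : halted (f 0) (iter u (step (f 0)) (init w)) by rewrite run /halted /=.
rewrite -(subnK le_u) iterD iter_step_halted // run.
by split; rewrite // /halted /=.
Qed.

(** * The program *)

(* Vertex i keeps its edges to i+1, ..., U i modulo n. *)
Definition deleted (n : nat) (U : nat -> nat) (i j : nat) : bool :=
  [&& i < j, U i < j & U j < n + i].

Definition ceil_div (x q : nat) : nat := (x + q.-1) %/ q.

(* floor((i+1)p/q) - floor(ip/q), see modn_share. *)
Definition share (p q i : nat) : nat := ((i * p) %% q + p) %/ q.

(* If p / q >= (n-2)/2, the surplus edges are all deleted at vertex 0. *)
Definition threshold (n p q i : nat) : nat :=
  if n * q <= (p + q).*2 then
    n.-1 - (i == 0) * ceil_div (q * 'C(n, 2) - n * p) q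
  else i + share p q i.

Definition row_word (n : nat) (U : nat -> nat) (i j : nat) : seq nat :=
  flatten (mkseq (fun j => if deleted n U i j then [:: i; j] else [::]) j).

Definition deletion_word (n : nat) (U : nat -> nat) (i : nat) : seq nat :=
  flatten (mkseq (fun i => row_word n U i n) i).

(* Registers: 0, 1 and 11 hold the constants 0, 1 and base, and 2, 3, 4 hold
   n, p, q; 5 and 6 hold the divisor e and the dividend s of round_to_tree;
   8 and 9 are loop counters; 12, 13, 14 hold nq, np and q times binomial(n, 2);
   20 holds ip mod q; 23 is set once the table has been filled.  The table U i
   is stored in register base + i. *)
Definition base := 32.

(** Division by counting: each of n rounds subtracts e from s, and the truncated [1 - (e - s)] is
    the indicator of e <= s, so the count is the quotient capped at n. *)
Definition round_code : frag :=
  seqf (block [:: Iconst 7 0; Iadd 8 2 0])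
 (seqf (loop 8 (block [:: Isub 10 5 6; Isub 10 1 10; Iadd 7 7 10; Isub 6 6 5;
                          Isub 8 8 1]))
       (block [:: Isub 3 7 1; Iadd 4 7 0])).

(** Multiplication by repeated addition; register 14 sums kq over k < n, which is q times
    binomial(n, 2). *)
Definition products_code : frag :=
  seqf (block [:: Iconst 12 0; Iconst 13 0; Iconst 14 0; Iadd 8 2 0])
       (loop 8 (block [:: Iadd 14 14 12; Iadd 12 12 4; Iadd 13 13 3;
                          Isub 8 8 1])).

Definition dense_code : frag :=
  seqf (block [:: Isub 15 14 13; Iconst 7 0; Iadd 8 2 0])
 (seqf (loop 8 (block [:: Isub 10 1 15; Isub 10 1 10; Iadd 7 7 10;
                          Isub 15 15 4; Isub 8 8 1]))
 (seqf (block [:: Isub 17 2 1; Iadd 16 11 0; Iadd 8 2 0])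
 (seqf (loop 8 (block [:: Istore 16 17; Iadd 16 16 1; Isub 8 8 1]))
       (block [:: Isub 17 17 7; Istore 11 17; Iconst 23 1])))).

(** As in Bresenham's algorithm, p is added to the last remainder and q is then subtracted as long
    as possible, in n rounds per vertex. *)
Definition sparse_code : frag :=
  seqf (block [:: Iconst 20 0; Iconst 18 0; Iadd 8 2 0])
       (loop 8
         (seqf (block [:: Iadd 20 20 3; Iadd 17 18 0; Iadd 9 2 0])
         (seqf (loop 9
                 (seqf (block [:: Isub 10 4 20])
                 (seqf (unless_pos 10 (block [:: Isub 20 20 4; Iadd 17 17 1]))
                       (block [:: Isub 9 9 1]))))
               (block [:: Iadd 16 11 18; Istore 16 17; Iadd 18 18 1;
                          Isub 8 8 1])))).

(** Register 21 adds the indicators of j <= i, j <= U i and n + i <= U j, so it is 0 exactly for the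
    deleted pairs. *)
Definition output_code : frag :=
  seqf (block [:: Iconst 18 0; Iadd 8 2 0])
       (loop 8
         (seqf (block [:: Iconst 19 0; Iadd 9 2 0])
         (seqf (loop 9
           (seqf (block [:: Isub 21 19 18; Isub 21 1 21;
                            Iadd 16 11 18; Iload 17 16; Isub 10 19 17;
                            Isub 10 1 10; Iadd 21 21 10;
                            Iadd 16 11 19; Iload 17 16; Iadd 22 2 18;
                            Isub 10 22 17; Isub 10 1 10; Iadd 21 21 10])
           (seqf (unless_pos 21 (block [:: Iprint 18; Iprint 19]))
                 (block [:: Iadd 19 19 1; Isub 9 9 1]))))
           (block [:: Iadd 18 18 1; Isub 8 8 1])))).

(** Register 10 is positive exactly when nq > 2(p + q); the flag in register 23 takes the place of
    an else branch. *)
Definition main_code : frag :=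
  seqf products_code
 (seqf (block [:: Iadd 10 3 4; Iadd 10 10 10; Isub 10 12 10; Iconst 23 0])
 (seqf (unless_pos 10 dense_code)
 (seqf (unless_pos 23 sparse_code)
       output_code))).

Definition round_main_code : frag :=
  seqf (block [:: Isub 10 1 5]) (seqf (unless_pos 10 round_code) main_code).

Record env (n p q : nat) (X : nat -> nat) : Prop := Env {
  env0 : X 0 = 0; env1 : X 1 = 1; env2 : X 2 = n; env3 : X 3 = p;
  env4 : X 4 = q; env11 : X 11 = base }.

(** * Correctness and running time of the fragments *)

Ltac run_block :=
  apply: triple_block => // X inp out;
  rewrite /block_post /exec /upd /=.

Ltac finish := repeat split => //=; try (unfold base in *; lia).

Ltac env_case := case=> [] [??????].

Lemma bin2_double n : 'C(n, 2).*2 = n * n.-1.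
Proof. by rewrite -mul2n -mul_bin_diag bin1. Qed.

Lemma triple_round n p q s e r0 : 0 < n -> 0 < e ->
  triple round_code (6 * n + 5)
    (fun X inp out => [/\ env n p q X, X 5 = e, X 6 = s & out = r0])
    (fun X inp out =>
       env n (minn n (s %/ e)).-1 (minn n (s %/ e)) X /\ out = r0).
Proof.
move=> n_gt0 e_gt0.
have : forall k, (k <= s %/ e) = (k * e <= s) by move=> k; rewrite leq_divRL.
move: (s %/ e) => d le_d.
pose I k (X : nat -> nat) (inp out : seq nat) :=
  [/\ env n p q X, X 5 = e, X 6 = s - k * e /\ X 8 = n - k,
      X 7 = minn k d & out = r0].
apply: (triple_time (t := 2 + (n * 6 + 2))); first by lia.
apply: (triple_seq (Q := I 0)).
  by run_block; env_case => *; finish.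
apply: (triple_seq (Q := I n)).
  apply: (triple_loop (t := 5)) => // [k X inp out [_ _ [_ ->]] //|k ltkn].
  run_block; env_case => ? [??] *; finish.
  by have := le_d k.+1; lia.
by run_block; env_case => ? [??] *; finish.
Qed.

Lemma triple_products n p q r0 : 0 < n ->
  triple products_code (5 * n + 4)
    (fun X inp out => env n p q X /\ out = r0)
    (fun X inp out => [/\ env n p q X, X 12 = n * q, X 13 = n * p,
       X 14 = q * 'C(n, 2) & out = r0]).
Proof.
move=> n_gt0.
pose I k (X : nat -> nat) (inp out : seq nat) :=
  [/\ env n p q X, X 12 = k * q, X 13 = k * p /\ X 8 = n - k,
      X 14 = q * 'C(k, 2) & out = r0].
apply: (triple_conseq (t := 4 + n * 5) (P' := fun X inp out =>
  env n p q X /\ out = r0) (Q' := I n)) => //; last first.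
- by move=> X inp out [? ? [? _] ? ?].
- by lia.
apply: (triple_seq (Q := I 0)).
  by run_block; env_case => *; finish; rewrite muln0.
apply: (triple_loop (t := 4)) => // [k X inp out [_ _ [_ ->]] //|k ltkn].
run_block; env_case => ? [??] *; finish.
by rewrite binS bin1; lia.
Qed.

Definition env_tab (n p q : nat) (U : nat -> nat) (k : nat) (X : nat -> nat) :=
  env n p q X /\ forall i, i < k -> X (base + i) = U i.

Lemma triple_dense n p q r0 : 0 < n -> 0 < q -> n * q <= (p + q).*2 ->
  triple dense_code (10 * n + 9)
    (fun X inp out => [/\ env n p q X, X 13 = n * p,
       X 14 = q * 'C(n, 2) & out = r0])
    (fun X inp out =>
       [/\ env_tab n p q (threshold n p q) n X, X 23 = 1 & out = r0]).
Proof.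
move=> n_gt0 q_gt0 dense.
set x := q * 'C(n, 2) - n * p.
(* The hypothesis [dense] gives 2x <= nq, so n rounds of subtracting q exhaust x. *)
have ceil_le : ceil_div x q <= n.
  rewrite /ceil_div -ltnS ltn_divLR // mulSn /x.
  by have := bin2_double n; nia.
pose I k (X : nat -> nat) (inp out : seq nat) :=
  [/\ env n p q X, X 15 = x - k * q, X 8 = n - k,
      X 7 = minn k (ceil_div x q) & out = r0].
pose J k (X : nat -> nat) (inp out : seq nat) :=
  [/\ env_tab n p q (fun=> n.-1) k X, X 16 = base + k, X 8 = n - k,
      X 7 = ceil_div x q /\ X 17 = n.-1 & out = r0].
apply: (triple_time (t := 3 + (n * 6 + (3 + (n * 4 + 3))))); first by lia.
apply: (triple_seq (Q := I 0)).
  by run_block; env_case => *; finish.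
apply: (triple_seq (Q := I n)).
  apply: (triple_loop (t := 5)) => // [k X inp out [_ _ -> //]|k ltkn].
  run_block; env_case => *; finish.
  have : (k.+1 <= ceil_div x q) = (k.+1 * q <= x + q.-1) by rewrite leq_divRL.
  by lia.
apply: (triple_seq (Q := J 0)).
  by run_block; env_case => *; finish.
apply: (triple_seq (Q := J n)).
  apply: (triple_loop (t := 3)) => // [k X inp out [_ _ -> //]|k ltkn].
  run_block => -[[[??????] tab] X16 ? [??] ?]; rewrite X16 /base; finish.
  move=> i; rewrite eqn_add2l; case: eqP => [-> //|ne] ltik.
  by apply: tab; lia.
run_block => -[[[????? X11] tab] _ _ [??] ?]; rewrite X11 /base; finish.
move=> i ltin; rewrite /threshold dense -[X in _ == X]addn0 eqn_add2l.
by case: eqP => ne /=; rewrite ?tab // -/x; lia.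
Qed.

(** The remainder of ip plus p is divided by q, leaving the remainder of (i+1)p. Summed over i this
    telescopes, which makes the shares add up to floor(np/q). *)
Lemma modn_share p q i :
  (i * p) %% q + p = q * share p q i + (i.+1 * p) %% q.
Proof. by rewrite mulSn [p + i * p]addnC -modnDml [q * _]mulnC -divn_eq. Qed.

Lemma triple_sparse n p q r0 : 0 < n -> 0 < q -> (p + q).*2 < n * q ->
  triple sparse_code (100 * n ^ 2)
    (fun X inp out => env n p q X /\ out = r0)
    (fun X inp out => env_tab n p q (threshold n p q) n X /\ out = r0).
Proof.
move=> n_gt0 q_gt0 sparse; set U := threshold n p q.
have [D [R DR]] : exists D R : nat -> nat, forall i,
  [/\ (i * p) %% q + p = q * D i + R i, R i < q, D i = share p q i
    & R i = (i.+1 * p) %% q].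
  exists (share p q), (fun i => (i.+1 * p) %% q) => i; split=> //.
    exact: modn_share.
  exact: ltn_pmod.
have UE i : U i = i + share p q i by rewrite /U /threshold leqNgt sparse.
(* Hence n rounds of the inner loop complete the division. *)
have share_le i : share p q i <= n.
  rewrite -ltnS ltn_divLR //; have := ltn_pmod (i * p) q_gt0; lia.
pose I k (X : nat -> nat) (inp out : seq nat) :=
  [/\ env_tab n p q U k X, X 18 = k, X 8 = n - k, X 20 = (k * p) %% q
    & out = r0].
(* The counter c is separate from k because the body performs round k before it decrements the
   counter. *)
pose J i k c (X : nat -> nat) (inp out : seq nat) :=
  [/\ env_tab n p q U i X /\ X 9 = c, X 18 = i, X 8 = n - i,
     X 20 = q * D i + R i - q * minn k (D i) /\ X 17 = i + minn k (D i)
   & out = r0].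
apply: (triple_conseq (t := 3 + n * (3 + (n * (1 + (3 + 1)).+1 + 4)).+1)
  (P' := fun X inp out => env n p q X /\ out = r0) (Q' := I n)) => //;
  last first.
- by move=> X inp out [].
- by nia.
apply: (triple_seq (Q := I 0)).
  run_block; env_case => *; finish.
  by rewrite mul0n mod0n.
apply: triple_loop => // [k X inp out [_ _ -> //]|i ltin].
apply: (triple_seq (Q := J i 0 (n - 0))).
  by run_block => -[[[??????] tab] ????]; have [] := DR i; finish.
apply: (triple_seq (Q := J i n (n - n))).
  apply: (triple_loop (Inv := fun k => J i k (n - k)))
    => // [k X inp out [[_ ->] //]|k ltkn].
  apply: (triple_seq (Q := fun X inp out => J i k (n - k) X inp out /\
     X 10 = q - (q * D i + R i - q * minn k (D i)))).
    by run_block => -[[[[??????] tab] ?] ?? [??] ?]; finish.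
  (* As R i < q, the rest is below q, and the subtraction is skipped, exactly when D i <= k. *)
  have [_ ltR _ _] := DR i.
  apply: (triple_seq (Q := J i k.+1 (n - k))).
    apply: triple_unless_pos.
      run_block => -[[[[[[??????] tab] ?] ?? [??] ?] z1] z2].
      case: (leqP (D i) k) => ltkD.
        by move: z1; rewrite z2 (minn_idPr _); lia.
      rewrite !(minn_idPl _) in z1 *; finish; nia.
    move=> X inp out [[[[[??????] tab] ?] ?? [??] ?] z1] z2.
    case: (leqP (D i) k) => leDk.
      by rewrite !(minn_idPr _) in z1 *; finish.
    by move: z1; rewrite (minn_idPl _); nia.
  by run_block => -[[[[??????] tab] ?] ?? [??] ?]; finish.
run_block => -[[[[????? X11] tab] ?] X18 ? [X20 X17] ?].
have [_ ltR DE RE] := DR i; have := share_le i.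
rewrite X11 X18 /base -DE => leD; finish.
  move=> k; rewrite eqn_add2l; case: eqP => [->|ne] ltki.
    by rewrite X17 UE -DE; lia.
  by apply: tab; lia.
Qed.

Lemma row_wordS n U i j : row_word n U i j.+1 =
  row_word n U i j ++ (if deleted n U i j then [:: i; j] else [::]).
Proof. by rewrite /row_word mkseqS flatten_rcons. Qed.

Lemma deletion_wordS n U i :
  deletion_word n U i.+1 = deletion_word n U i ++ row_word n U i n.
Proof. by rewrite /deletion_word mkseqS flatten_rcons. Qed.

Lemma triple_output n p q U : 0 < n ->
  triple output_code (100 * n ^ 2)
    (fun X inp out => env_tab n p q U n X /\ out = [::])
    (fun X inp out => out = deletion_word n U n).
Proof.
move=> n_gt0.
pose I k (X : nat -> nat) (inp out : seq nat) :=
  [/\ env_tab n p q U n X, X 18 = k, X 8 = n - k & out = deletion_word n U k].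
pose J i k k' (X : nat -> nat) (inp out : seq nat) :=
  [/\ env_tab n p q U n X, X 18 = i /\ X 8 = n - i, X 19 = k, X 9 = n - k
    & out = deletion_word n U i ++ row_word n U i k'].
apply: (triple_conseq (t := 2 + n * (2 + (n * (13 + (3 + 2)).+1 + 2)).+1)
  (P' := fun X inp out => env_tab n p q U n X /\ out = [::]) (Q' := I n)) => //;
  last first.
- by move=> X inp out [].
- by nia.
apply: (triple_seq (Q := I 0)).
  by run_block => -[[[??????] tab] ?]; finish.
apply: triple_loop => // [k X inp out [_ _ -> //]|i ltin].
apply: (triple_seq (Q := J i 0 0)).
  by run_block => -[[[??????] tab] ?? ->]; finish; rewrite cats0.
apply: (triple_seq (Q := J i n n)).
  apply: (triple_loop (Inv := fun k => J i k k))
    => // [k X inp out [_ _ _ -> //]|k ltkn].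
  apply: (triple_seq (Q := fun X inp out => J i k k X inp out /\
     (X 21 == 0) = deleted n U i k)).
    run_block => -[[[????? X11] tab] [X18 ?] X19 ? ?].
    rewrite X11 X18 X19 !tab //; finish.
    by rewrite /deleted; lia.
  apply: (triple_seq (Q := J i k k.+1)).
    apply: triple_unless_pos.
      run_block => -[[[[[??????] tab] [X18 ?] X19 ? ->] del] X21]; finish.
      by rewrite row_wordS -del X21 X18 X19 -!cats1 -!catA.
    move=> X inp out [[tab [X18 ?] X19 ? ->] del] X21; split=> //.
    by rewrite row_wordS -del; case: eqP X21 => [->//|_ _]; rewrite cats0.
  by run_block => -[[[??????] tab] [??] ?? ?]; finish.
by run_block => -[[[??????] tab] [??] ?? ->]; finish; rewrite deletion_wordS.
Qed.

Lemma triple_main n p q : 0 < n -> 0 < q ->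
  triple main_code (300 * n ^ 2)
    (fun X inp out => env n p q X /\ out = [::])
    (fun X inp out => out = deletion_word n (threshold n p q) n).
Proof.
move=> n_gt0 q_gt0.
apply: (triple_time (t := (5 * n + 4) + (4 + ((10 * n + 9).+1 +
  ((100 * n ^ 2).+1 + 100 * n ^ 2))))); first by nia.
apply: triple_seq; first exact: triple_products.
set z := n * q - (p + q).*2.
apply: (triple_seq (Q := fun X inp out => [/\ env n p q X, X 13 = n * p,
    X 14 = q * 'C(n, 2), out = [::] & X 10 = z /\ X 23 = 0])).
  by run_block; env_case => *; finish; rewrite /z; lia.
apply: (triple_seq (Q := fun X inp out =>
    if n * q <= (p + q).*2 then
      [/\ env_tab n p q (threshold n p q) n X, X 23 = 1 & out = [::]]
    else [/\ env n p q X, X 23 = 0 & out = [::]])).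
  apply: triple_unless_pos; last first.
    move=> X inp out [? _ _ ? [X10 ?]].
    by rewrite X10 subn_gt0 ltnNge => /negbTE ->.
  case: leqP => [dense|sparse].
    apply: (triple_conseq (triple_dense (r0 := [::]) n_gt0 q_gt0 dense)) => //.
    by move=> X inp out [[]].
  move=> pre post X inp out [[_ _ _ _ [-> _]]] /eqP.
  by rewrite subn_eq0 leqNgt sparse.
apply: triple_seq; last exact: (triple_output (p := p) (q := q)).
apply: triple_unless_pos; last first.
  by move=> X inp out; case: ifP => _ [? -> ?] // _; split.
case: leqP => [dense|sparse].
  by move=> pre post X inp out [[_ ->]].
apply: (triple_conseq (triple_sparse (r0 := [::]) n_gt0 q_gt0 sparse)) => //.
by move=> X inp out [[]].
Qed.

(* With e = q - p and s = q, this is the largest density (K-1)/K <= p/q with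
   K <= n; with s = q + e - 1, it is the smallest (K-1)/K >= p/q. *)
Definition round_to_tree (n p q s e : nat) : nat * nat :=
  if e == 0 then (p, q)
  else ((minn n (s %/ e)).-1, minn n (s %/ e)).

Lemma triple_round_main n p q s e : 0 < n ->
  let pq := round_to_tree n p q s e in 0 < pq.2 ->
  triple round_main_code (400 * n ^ 2)
    (fun X inp out => [/\ env n p q X, X 5 = e, X 6 = s & out = [::]])
    (fun X inp out => out = deletion_word n (threshold n pq.1 pq.2) n).
Proof.
move=> n_gt0 pq pq2.
apply: (triple_time (t := 1 + ((6 * n + 5).+1 + 300 * n ^ 2))); first by nia.
apply: (triple_seq (Q := fun X inp out =>
    [/\ env n p q X, X 5 = e, X 6 = s & out = [::]] /\ X 10 = 1 - e)).
  by run_block; env_case => *; finish.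
apply: triple_seq; last exact: triple_main.
apply: triple_unless_pos; last first.
  move=> X inp out [[? _ _ ?] ->]; rewrite /pq /round_to_tree.
  by case: eqP => [-> //|]; lia.
case: (posnP e) => [e0|e_gt0].
  by move=> pre post X inp out [[_ ->]]; rewrite e0.
rewrite /pq /round_to_tree -[e == 0]negbK -lt0n e_gt0 /=.
apply: (triple_conseq (triple_round (p := p) (q := q) (s := s) (r0 := [::])
  n_gt0 e_gt0)) => //.
by move=> X inp out [[]].
Qed.

(** * Reading the instance *)

Definition bounded_density_code : frag :=
  seqf (block [:: Iread 2; Iread 3; Iread 4; Iconst 1 1; Iconst 11 base;
                  Isub 5 4 3; Iadd 6 4 0; Isub 10 1 2])
       (unless_pos 10 round_main_code).

(** At least m = binomial(n, 2) - k edges survive, so the target density is m / n. The loop sums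
    binomial(n, 2) in register 3 while register 4 counts up to n; the dividend n + e - 1 then rounds
    the quotient n / e up. *)
Definition density_code : frag :=
  seqf (block [:: Iread 2; Iread 7; Iconst 1 1; Iconst 11 base; Isub 10 1 2])
       (unless_pos 10
         (seqf (block [:: Iadd 8 2 0])
         (seqf (loop 8 (block [:: Iadd 3 3 4; Iadd 4 4 1; Isub 8 8 1]))
         (seqf (block [:: Isub 3 3 7; Isub 5 4 3; Iadd 6 4 5; Isub 6 6 1])
               round_main_code)))).

Definition started (w : seq nat) : assertion :=
  fun X inp out => [/\ X = (fun=> 0), inp = w & out = [::]].

Lemma triple_bounded_density n p q w :
  let pq := round_to_tree n p q q (q - p) in 0 < n -> 0 < pq.2 ->
  triple bounded_density_code (500 * n ^ 2)
    (started [:: n, p, q & w])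
    (fun X inp out => out = deletion_word n (threshold n pq.1 pq.2) n).
Proof.
move=> pq n_gt0 pq2.
apply: (triple_time (t := 8 + (400 * n ^ 2).+1)); first by nia.
apply: (triple_seq (Q := fun X inp out =>
  [/\ env n p q X, X 5 = q - p, X 6 = q & out = [::]] /\ X 10 = 0)).
  by run_block => -[-> -> ->] /=; finish.
apply: triple_unless_pos; last by move=> X inp out [_ ->].
apply: (triple_conseq (triple_round_main n_gt0 pq2)) => //.
by move=> X inp out [[]].
Qed.

Lemma triple_density n k w :
  let p := 'C(n, 2) - k in
  let pq := round_to_tree n p n (n + (n - p) - 1) (n - p) in
  0 < n -> 0 < pq.2 ->
  triple density_code (500 * n ^ 2)
    (started [:: n, k & w])
    (fun X inp out => out = deletion_word n (threshold n pq.1 pq.2) n).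
Proof.
move=> p pq n_gt0 pq2.
apply: (triple_time (t := 5 + (1 + (n * 4 + (4 + 400 * n ^ 2))).+1));
  first by nia.
apply: (triple_seq (Q := fun X inp out =>
  [/\ env n 0 0 X, X 7 = k & out = [::]] /\ X 10 = 0)).
  by run_block => -[-> -> ->] /=; finish.
apply: triple_unless_pos; last by move=> X inp out [_ ->].
pose I k' (X : nat -> nat) (inp out : seq nat) :=
  [/\ env n 'C(k', 2) k' X, X 7 = k, X 8 = n - k' & out = [::]].
apply: (triple_seq (Q := I 0)).
  by run_block => -[] [] [[??????]] *; finish.
apply: (triple_seq (Q := I n)).
  apply: (triple_loop (t := 3)) => // [k' X inp out [_ _ -> //]|k' ltkn].
  run_block; env_case => *; finish.
  by rewrite binS bin1; lia.
apply: (triple_seq (Q := fun X inp out => [/\ env n p n X, X 5 = n - p,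
    X 6 = n + (n - p) - 1 & out = [::]])).
  by run_block; env_case => *; finish; rewrite /p; lia.
exact: triple_round_main.
Qed.

(** For n = 0 everything after the first block must be skipped, as a [loop] runs its body at least
    once. *)
Lemma triple_bounded_density0 w :
  triple bounded_density_code (8 + 1) (started (0 :: w))
    (fun X inp out => out = [::]).
Proof.
apply: (triple_seq (Q := fun X inp out => X 10 = 1 /\ out = [::])).
  by run_block => -[_ -> ->].
apply: triple_unless_pos => [pre post X inp out [[->]] //|].
by move=> X inp out [].
Qed.

Lemma triple_density0 w :
  triple density_code (5 + 1) (started (0 :: w)) (fun X inp out => out = [::]).
Proof.
apply: (triple_seq (Q := fun X inp out => X 10 = 1 /\ out = [::])).
  by run_block => -[_ -> ->].
apply: triple_unless_pos => [pre post X inp out [[->]] //|].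
by move=> X inp out [].
Qed.

(** * Loads of the kept edges *)

Definition kept_in (n : nat) (U : nat -> nat) (s : pred nat) : nat :=
  \sum_(i < n) \sum_(j < n) [&& s i, s j, i < j & ~~ deleted n U i j].

Lemma sum_ord_lt n a : \sum_(j < n) (j < a) = minn n a.
Proof.
elim: n => [|n IH]; first by rewrite big_ord0 min0n.
by rewrite big_ord_recr /= IH; lia.
Qed.

Lemma sum_ord_pairs n (s : pred nat) :
  \sum_(i < n) \sum_(j < n) [&& s i, s j & i < j] = 'C(\sum_(i < n) s i, 2).
Proof.
elim: n => [|n IH]; first by rewrite !big_ord0.
rewrite !big_ord_recr /= [X in _ + (X + _)]big1 => [|i _]; last first.
  by rewrite ltnNge ltnW ?andbF.
under eq_bigr do rewrite big_ord_recr /=.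
rewrite big_split /= IH ltnn !andbF !addn0.
under [X in _ + X]eq_bigr => i _ do rewrite ltn_ord andbT.
case: (s n); last by rewrite [X in _ + X]big1 ?addn0 // => i _; rewrite andbF.
under [X in _ + X]eq_bigr => i _ do rewrite andbT.
by rewrite addn1 binS bin1.
Qed.

Lemma sum_ord_all n : \sum_(i < n) predT (nat_of_ord i) = n.
Proof. by rewrite sum1_card card_ord. Qed.

(** Cyclic reindexing: what each i passes on to i+1 is counted at the receiver instead, the
    predecessor of 0 being n-1. *)
Lemma sum_mul_succ_mod n (f g : nat -> nat) : 0 < n ->
  \sum_(i < n) f i * g (i.+1 %% n) =
  \sum_(i < n) g i * (if nat_of_ord i is i'.+1 then f i' else f n.-1).
Proof.
case: n => // m _; rewrite big_ord_recr big_ord_recl /= modnn addnC mulnC.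
congr (_ + _); apply: eq_bigr => i _.
by rewrite modn_small ?ltnS // mulnC.
Qed.

(** * Bounds p / q of at least (n-2)/2 *)

Section Dense.

Variables n p q : nat.
Hypotheses (n_gt0 : 0 < n) (q_gt0 : 0 < q) (dense : n * q <= (p + q).*2).

Let t := ceil_div (q * 'C(n, 2) - n * p) q.

(** t is the least number of deletions that brings the whole graph down to density p / q. The
    hypothesis [dense] keeps it below n, so that vertex 0 has enough edges for all of them. *)
Lemma dense_excess :
  [/\ q * 'C(n, 2) <= n * p + q * t, t = 0 \/ n * p < q * ('C(n, 2) - t).+1
    & t < n].
Proof.
have bn := bin2_double n.
rewrite /t /ceil_div; set x := _ - _.
have tE := divn_eq (x + q.-1) q; have := ltn_pmod (x + q.-1) q_gt0.
move: (_ %/ q) (_ %% q) tE => t' r tE ltr.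
have xE : x = q * 'C(n, 2) - n * p by [].
have lt_tn : t' < n by nia.
split=> //; first by lia.
case: (posnP t') => [->|t_gt0]; [by left|right].
by nia.
Qed.

Lemma kept_dense : kept_in n (threshold n p q) predT = 'C(n, 2) - t.
Proof.
have [_ _ lt_tn] := dense_excess.
have N : 'C(n, 2) = \sum_(i < n) \sum_(j < n) [&& true, true & i < j].
  by rewrite (sum_ord_pairs n predT) sum_ord_all.
suff del : \sum_(i < n) \sum_(j < n) deleted n (threshold n p q) i j = t.
  rewrite N -{1}del -sumnB => [|i _].
    apply: eq_bigr => i _.
    rewrite -sumnB => [|j _]; rewrite /deleted; last by lia.
    by apply: eq_bigr => j _; rewrite /deleted /=; lia.
  by apply: leq_sum => j _; rewrite /deleted /=; lia.
have delE i j : j < n -> deleted n (threshold n p q) i j =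
    (i == 0) && (n.-1 - t < j).
  by move=> ltj; rewrite /deleted /threshold dense -/t; case: i => [|i] /=; lia.
case: n n_gt0 lt_tn delE => // m _ lt_tm delE.
rewrite big_ord_recl [X in _ + X]big1 ?addn0 => [|i _]; last first.
  by rewrite big1 // => j _; rewrite delE.
have cnt : \sum_(j < m.+1) (m - t < j) = t.
  have := sum_ord_lt m.+1 (m - t).+1.
  have : \sum_(j < m.+1) (j < (m - t).+1) + \sum_(j < m.+1) (m - t < j) = m.+1.
    rewrite -big_split /= -[RHS](sum_ord_all m.+1).
    by apply: eq_bigr => j _ /=; lia.
  by lia.
by rewrite -[RHS]cnt; apply: eq_bigr => j _; rewrite delE.
Qed.

(** On the whole vertex set the choice of t decides. A proper subset of a >= 1 vertices has density
    at most (a-1)/2 <= (n-2)/2 <= p / q, even with all its edges. *)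
Lemma kept_dense_load (s : pred nat) :
  q * kept_in n (threshold n p q) s <= p * \sum_(i < n) s i.
Proof.
have [le_t _ lt_tn] := dense_excess.
have [all_s|] := boolP [forall i : 'I_n, s i].
  have -> : \sum_(i < n) s i = n.
    rewrite -[RHS]sum_ord_all; apply: eq_bigr => i _.
    by rewrite (forallP all_s).
  have -> : kept_in n (threshold n p q) s = kept_in n (threshold n p q) predT.
    apply: eq_bigr => i _; apply: eq_bigr => j _.
    by rewrite !(forallP all_s).
  by rewrite kept_dense; nia.
rewrite negb_forall => /existsP[i0 si0].
set a := \sum_(i < n) _.
have lt_an : a < n.
  rewrite /a -[X in _ < X]sum_ord_all (bigD1 i0) //= (negbTE si0).
  by rewrite [X in _ < X](bigD1 i0) //= ltnS; apply: leq_sum => i _;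
    case: (s i).
have : kept_in n (threshold n p q) s <= 'C(a, 2).
  rewrite -sum_ord_pairs; apply: leq_sum => i _; apply: leq_sum => j _.
  by case: (s i); case: (s j) => //=; case: (i < j); case: deleted.
have := bin2_double a; move: (kept_in _ _ _) => e aE le_e.
case: a lt_an aE le_e => [|a] lt_an aE le_e.
  by rewrite bin0n in le_e; lia.
have le_aq : a * q <= p.*2 by nia.
have le_2e : e.*2 <= a.+1 * a by rewrite /= in aE; lia.
rewrite -leq_double doubleMr doubleMl.
apply: (@leq_trans (q * (a.+1 * a))); first by rewrite leq_mul2l le_2e orbT.
by rewrite mulnCA mulnC leq_mul2r mulnC le_aq orbT.
Qed.

End Dense.

(** * Bounds p / q below (n-2)/2 *)

Section Sparse.

Variables (n p q : nat) (D L : nat -> nat).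
Hypotheses (n_gt0 : 0 < n) (q_gt0 : 0 < q).
(* In the application D i = ip mod q and L i = share p q i. *)
Hypotheses (D0 : D 0 = 0) (D_lt : forall i, D i < q).
Hypothesis (DL : forall i, D i + p = q * L i + D i.+1).
Hypothesis (L_lt : forall i, (L i).*2 < n).

Let U i := i + L i.

(** Membership of j in the cyclic arc that follows i; the second summand is the part that wraps
    around past n-1. *)
Let arc i j : nat := (i < j <= U i) + (n + j <= U i).

Lemma sum_arc i : i < n -> \sum_(j < n) arc i j = L i.
Proof.
move=> ltin; have := L_lt i => ltL.
have S1 : \sum_(j < n) (i < j <= U i) = minn n (U i).+1 - minn n i.+1.
  rewrite -!sum_ord_lt -sumnB => [|j _]; last by rewrite /U; lia.
  by apply: eq_bigr => j _; rewrite /U; lia.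
have S2 : \sum_(j < n) (n + j <= U i) = minn n ((U i).+1 - n).
  by rewrite -sum_ord_lt; apply: eq_bigr => j _; lia.
by rewrite big_split /= S1 S2 /U; lia.
Qed.

(** As 2 L i < n for all i, two vertices never lie on each other's arcs, so each kept edge is
    counted at exactly one of its ends. *)
Lemma kept_in_arc (s : pred nat) :
  kept_in n U s = \sum_(i < n) s i * \sum_(j < n) s j * arc i j.
Proof.
have keptE i j : i < n -> j < n -> [&& s i, s j, i < j & ~~ deleted n U i j] =
    s i * s j * (i < j <= U i) + s j * s i * (n + i <= U j) :> nat.
  move=> ltin ltjn; have := L_lt i; have := L_lt j; rewrite /deleted /U.
  by case: (s i); case: (s j) => //=; lia.
rewrite /kept_in.
transitivity (\sum_(i < n) \sum_(j < n) (s i * s j * (i < j <= U i)) +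
   \sum_(i < n) \sum_(j < n) (s j * s i * (n + i <= U j))).
  rewrite -big_split; apply: eq_bigr => i _ /=.
  by rewrite -big_split; apply: eq_bigr => j _ /=; rewrite keptE.
rewrite [X in _ + X]exchange_big /= -big_split; apply: eq_bigr => i _ /=.
rewrite -big_split big_distrr; apply: eq_bigr => j _ /=.
by rewrite /arc; case: (s i); case: (s j); lia.
Qed.

Lemma kept_sparse : kept_in n U predT = (n * p) %/ q.
Proof.
rewrite kept_in_arc.
under eq_bigr => i _.
  rewrite mul1n; under eq_bigr do rewrite mul1n.
  rewrite sum_arc //; over.
have E : q * (\sum_(i < n) L i) + D n = n * p.
  elim: n => [|m IH]; first by rewrite big_ord0 D0 muln0.
  have := DL m; rewrite big_ord_recr /= mulnDr mulSn -IH.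
  by move: (\sum_(i < m) _) => S; lia.
by rewrite -E mulnC divnMDl // divn_small // addn0.
Qed.

Hypothesis (q_le : q <= p.+1).

Lemma kept_sparse_load (s : pred nat) :
  q * kept_in n U s <= p * \sum_(i < n) s i.
Proof.
(* x i / q is the part of the weight of the edge {i, i+1} that moves from i to
   i+1; it vanishes when i keeps no edge because q <= p + 1. *)
rewrite kept_in_arc; pose x i := q.-1 - D i.+1.
pose c i := \sum_(j < n) s j * arc i j.
(* If i+1 is outside s, then i is spared an edge of weight q, which covers the x i that it can no
   longer pass on. *)
have row i : i < n -> q * c i + x i <= q * L i + x i * s (i.+1 %% n).
  move=> ltin; rewrite -(sum_arc ltin) /c.
  case: (boolP (s _)) => si /=.
    rewrite muln1 leq_add2r leq_mul2l leq_sum ?orbT // => j _.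
    by case: (s j); rewrite ?mul1n.
  rewrite muln0 addn0; case: (posnP (L i)) => [Li0|L_gt0].
    have := DL i; have := D_lt i.+1; rewrite Li0 muln0 => Dlt DE.
    have -> : x i = 0 by rewrite /x; lia.
    rewrite addn0 leq_mul2l leq_sum ?orbT // => j _.
    by case: (s j); rewrite ?mul1n.
  pose j0 := Ordinal (ltn_pmod i.+1 n_gt0).
  rewrite (bigD1 j0) //= (negbTE si) mul0n add0n [in leqRHS](bigD1 j0) //=.
  have arc_gt0 : 0 < arc i j0.
    rewrite /arc /j0 /=; case: (ltnP i.+1 n) => [lt1|ge1].
      by rewrite modn_small // /U; lia.
    have -> : i.+1 = n by lia.
    by rewrite modnn /U; lia.
  have le_sum : \sum_(j < n | j != j0) s j * arc i j <=
      \sum_(j < n | j != j0) arc i j.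
    by apply: leq_sum => j _; case: (s j); rewrite ?mul1n.
  rewrite mulnDr addnC leq_add //; last by rewrite leq_mul2l le_sum orbT.
  by apply: (@leq_trans q); [rewrite /x; lia | exact: leq_pmulr].
pose y i := if i is i'.+1 then x i' else x n.-1.
have shift : \sum_(i < n) x i * s (i.+1 %% n) = \sum_(i < n) s i * y i.
  exact: (sum_mul_succ_mod x (fun i => s i)).
suff : q * (\sum_(i < n) s i * c i) + \sum_(i < n) s i * x i <=
    p * \sum_(i < n) s i + \sum_(i < n) s i * x i by rewrite leq_add2r.
apply: (@leq_trans (\sum_(i < n) s i * (q * L i) + \sum_(i < n) s i * y i)).
  rewrite -shift big_distrr -!big_split /=; apply: leq_sum => i _.
  have := row i (ltn_ord i); case: (s i); last by rewrite !mul0n muln0.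
  by rewrite !mul1n.
rewrite big_distrr -!big_split /=; apply: leq_sum => i _.
case: (s i); last by rewrite !mul0n muln0.
(* For i > 0, q L i + y i = p + x i by [DL]; at i = 0 only <= holds, because D 0 = 0 <= D n. *)
rewrite !mul1n muln1; have := DL i; have := D_lt i.+1; have := D_lt i.
by rewrite /y /x; case: (nat_of_ord i) => [|k]; rewrite ?D0; lia.
Qed.

End Sparse.

Lemma eq_kept_in n U U' s : U =1 U' -> kept_in n U s = kept_in n U' s.
Proof.
move=> eqU; apply: eq_bigr => i _; apply: eq_bigr => j _.
by rewrite /deleted !eqU.
Qed.

Lemma share_lt n p q i : 0 < q -> (p + q).*2 < n * q -> (share p q i).*2 < n.
Proof.
move=> q_gt0 sparse; have := modn_share p q i; have := ltn_pmod (i * p) q_gt0.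
by move: (share p q i) (_ %% q) (_ %% q) => L D D'; nia.
Qed.

Lemma threshold_sparse n p q : (p + q).*2 < n * q ->
  threshold n p q =1 (fun i => i + share p q i).
Proof. by move=> sparse i; rewrite /threshold leqNgt sparse. Qed.

Lemma threshold_load n p q (s : pred nat) : 0 < n -> 0 < q <= p.+1 ->
  q * kept_in n (threshold n p q) s <= p * \sum_(i < n) s i.
Proof.
move=> n_gt0 /andP[q_gt0 q_le].
have [dense|sparse] := leqP (n * q) (p + q).*2; first exact: kept_dense_load.
rewrite (eq_kept_in _ _ (threshold_sparse sparse)).
apply: (kept_sparse_load (D := fun i => (i * p) %% q)) => //.
- by rewrite mod0n.
- by move=> i; exact: ltn_pmod.
- exact: modn_share.
- by move=> i; exact: share_lt sparse.
Qed.

(** The counterpart of the load bound: as many edges are kept as density p / q on n vertices allows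
    at all. *)
Lemma threshold_count n p q : 0 < n -> 0 < q ->
  minn 'C(n, 2) ((n * p) %/ q) <= kept_in n (threshold n p q) predT.
Proof.
move=> n_gt0 q_gt0.
have [dense|sparse] := leqP (n * q) (p + q).*2.
  rewrite kept_dense //; have [_ + _] := dense_excess n_gt0 q_gt0 dense.
  case=> [->|lt_np]; first by rewrite subn0 geq_minl.
  by rewrite geq_min -[_ %/ _ <= _]ltnS ltn_divLR // [_.+1 * _]mulnC lt_np orbT.
rewrite (eq_kept_in _ _ (threshold_sparse sparse)).
rewrite (@kept_sparse n p q (fun i => (i * p) %% q)) ?geq_minr //.
- by rewrite mod0n.
- by move=> i; exact: ltn_pmod.
- exact: modn_share.
- by move=> i; exact: share_lt sparse.
Qed.

(** * Density of subgraphs *)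

Section Density.

Variable V : finType.
Implicit Types (E F : {set {set V}}) (S A : {set V}) (G H : sgraph V).

Definition edges_in E S : {set {set V}} := [set e in E | e \subset S].

Lemma edges_in_graph E S (E2 : forall e, e \in E -> #|e| = 2) :
  is_graph (S, edges_in E S).
Proof.
apply/forall_inP => e; rewrite inE => /andP[eE ->].
by rewrite E2.
Qed.

Lemma eset_card2 G e : e \in eset G -> #|e| = 2.
Proof. by move=> eG; have /forall_inP/(_ e eG)/andP[/eqP] := gpairP G. Qed.

Lemma eset_sub G e : e \in eset G -> e \subset vset G.
Proof. by move=> eG; have /forall_inP/(_ e eG)/andP[] := gpairP G. Qed.

Lemma density_le (m v p q : nat) : 0 < q ->
  (m%:R / v%:R <= p%:R / q%:R :> rat)%R = (v == 0) || (q * m <= p * v).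
Proof.
(* For v = 0 the left quotient is 0 by convention, so the inequality holds. *)
move=> q_gt0; case: (posnP v) => [->|v_gt0].
  by rewrite invr0 mulr0 divr_ge0 ?ler0n.
rewrite ler_pdivrMr ?ltr0n // mulrAC ler_pdivlMr ?ltr0n //.
by rewrite -!natrM ler_nat mulnC.
Qed.

(** Induced subgraphs suffice, having the most edges on a given vertex set. *)
Lemma max_density_le G p q : 0 < q ->
  (forall S, S \subset vset G -> q * #|edges_in (eset G) S| <= p * #|S|) <->
  (max_density G <= p%:R / q%:R)%R.
Proof.
move=> q_gt0; rewrite /max_density; split=> [loads|].
  apply/bigmax_leP; split=> [|H /andP[vH eH]]; first by rewrite divr_ge0 ?ler0n.
  rewrite density_le //; apply/orP; right.
  apply: leq_trans (loads _ vH); rewrite leq_mul2l subset_leq_card ?orbT //.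
  by apply/subsetP => e eHe; rewrite inE (subsetP eH) //= (eset_sub eHe).
move=> /bigmax_leP[_ dens] S SG.
pose H := SGraph (edges_in_graph S (@eset_card2 G)).
have : subgraph H G.
  by rewrite /subgraph SG; apply/subsetP => e; rewrite inE => /andP[].
move=> /dens; rewrite density_le // => /orP[/eqP S0|//].
move: S0; rewrite /vset /= => S0; rewrite S0 muln0 leqn0 muln_eq0.
apply/orP; right; rewrite cards_eq0; apply/eqP/setP => e; rewrite !inE.
apply/negP => /andP[/eset_card2 e2 /subset_leq_card]; by rewrite e2 S0.
Qed.

Lemma density_le_max G S : S \subset vset G ->
  (#|edges_in (eset G) S|%:R / #|S|%:R <= max_density G :> rat)%R.
Proof.
move=> SG; pose H := SGraph (edges_in_graph S (@eset_card2 G)).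
have HG : subgraph H G.
  by rewrite /subgraph SG; apply/subsetP => e; rewrite inE => /andP[].
rewrite -[X in (X <= _)%R]/(density H) /max_density.
by apply: le_bigmax_cond.
Qed.

(** For A inside S: A is a union of components of the graph induced on S. Connectivity is the
    absence of a proper nonempty such A, which avoids paths. *)
Definition separated E S A : bool :=
  [forall e in edges_in E S, (e \subset A) || (e \subset S :\: A)].

Lemma card_edges_separated E S A : A \subset S -> separated E S A ->
  #|edges_in E S| <= #|edges_in E A| + #|edges_in E (S :\: A)|.
Proof.
move=> AS sep; rewrite -cardsUI; apply: leq_trans (leq_addr _ _).
apply/subset_leq_card/subsetP => e eS.
by have := forall_inP sep e eS; move: eS; rewrite !inE => /andP[-> _].
Qed.

(** A spanning tree is grown inside S: as long as A is not S, some edge leaves A and adds one vertex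
    together with one edge. *)
Lemma card_edges_connected E S : (forall e, e \in E -> #|e| = 2) ->
  (forall A, A \subset S -> A != set0 -> A != S -> ~~ separated E S A) ->
  #|S| <= #|edges_in E S|.+1.
Proof.
move=> E2 conn.
suff grow k : k < #|S| ->
    exists A, [/\ A \subset S, #|A| = k.+1 & k <= #|edges_in E A|].
  case: (posnP #|S|) => [->//|S_gt0]; have := grow #|S|.-1.
  rewrite prednK // => /(_ (leqnn _))[A [AS cA eA]].
  have /eqP <- : A == S by rewrite eqEcard AS cA leqnn.
  by lia.
elim: k => [|k IH] ltk.
  have /card_gt0P[x xS] : 0 < #|S| by [].
  by exists [set x]; rewrite sub1set cards1.
have [A [AS cA eA]] := IH (ltnW ltk).
have A0 : A != set0 by rewrite -card_gt0 cA.
have AnS : A != S by apply/eqP => AeqS; move: ltk; rewrite -AeqS cA ltnn.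
have := conn A AS A0 AnS; rewrite negb_forall => /existsP[e].
rewrite negb_imply negb_or => /and3P[eS enA enSA].
move: (eS); rewrite inE => /andP[eE esS].
have [y ye ynA] := subsetPn enA.
have yS : y \in S by apply: (subsetP esS).
have eyA : e \subset y |: A.
  have [x [z [xz eE2]]] : exists x z, x != z /\ e = [set x; z].
    by have /cards2P[x [z [xz ->]]] : #|e| == 2; [rewrite E2|exists x, z].
  have [w we] := subsetPn enSA.
  rewrite inE negb_and negbK => /orP[wA|]; last first.
    by rewrite (subsetP esS).
  apply/subsetP => v ve; rewrite !inE; case: eqP => //= /eqP vy.
  suff -> : v = w by [].
  have wy : w != y by apply: contraNneq ynA => <-.
  move: ve we ye; rewrite eE2 !inE.
  by move=> /orP[]/eqP ev /orP[]/eqP ew /orP[]/eqP ey;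
    move: vy wy; rewrite ev ew ey ?eqxx.
exists (y |: A); split.
- by rewrite subUset sub1set yS.
- by rewrite cardsU1 ynA cA.
have ne : e \notin edges_in E A by rewrite inE (negbTE enA) andbF.
apply: (@leq_trans #|e |: edges_in E A|); first by rewrite cardsU1 ne.
apply/subset_leq_card/subsetP => f; rewrite !inE.
case/orP=> [/eqP->|/andP[-> fA]]; first by rewrite eE.
by apply: subset_trans fA _; apply: subsetUr.
Qed.

(* Below 1 the only densities that can be maximal are those (k - 1) / k of
   trees: a smallest set denser than (K - 1) / K is connected, and so contains
   the edges of a tree. *)
Lemma dense_subset E S K : (forall e, e \in E -> #|e| = 2) -> 0 < K ->
  K.-1 * #|S| < K * #|edges_in E S| ->
  exists A, [/\ A \subset S, A != set0 & K * #|A| <= K.+1 * #|edges_in E A|].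
Proof.
move=> E2 K_gt0; have [m] := ubnP #|S|; elim: m S => // m IH S ltm dense.
have S0 : S != set0.
  apply: contraTneq dense => ->; rewrite -leqNgt (_ : edges_in E set0 = set0).
    by rewrite cards0 !muln0.
  apply/setP => e; rewrite !inE; apply/negP => /andP[/E2 e2].
  by rewrite subset0 => /eqP e0; rewrite e0 cards0 in e2.
case: (boolP [exists A : {set V},
    [&& A \subset S, A != set0, A != S & separated E S A]]) => [/existsP[A]|].
  case/and4P=> AS A0 AnS sep.
  have cS : #|S| = #|A| + #|S :\: A| by rewrite -(cardsID A S) (setIidPr AS).
  have A_gt0 : 0 < #|A| by rewrite card_gt0.
  have SA_gt0 : 0 < #|S :\: A|.
    rewrite card_gt0; apply: contra AnS => /eqP SA0.
    by rewrite eqEsubset AS -setD_eq0 SA0 eqxx.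
  have le_e := card_edges_separated AS sep.
  (* No edge joins A to the rest of S, so one of the two parts is again denser than (K-1)/K. *)
  case: (ltnP (K.-1 * #|A|) (K * #|edges_in E A|)) => [dA|sA].
    have [|B [BA B0 dB]] := IH A _ dA; first by lia.
    by exists B; split=> //; apply: subset_trans AS.
  have dSA : K.-1 * #|S :\: A| < K * #|edges_in E (S :\: A)|.
    rewrite cS mulnDr in dense.
    have : K * #|edges_in E S| <=
        K * #|edges_in E A| + K * #|edges_in E (S :\: A)|.
      by rewrite -mulnDr leq_mul2l le_e orbT.
    by lia.
  have [|B [BA B0 dB]] := IH _ _ dSA; first by lia.
  by exists B; split=> //; apply: subset_trans BA (subsetDl _ _).
move=> conn; exists S; split=> //.
have : #|S| <= #|edges_in E S|.+1.
  apply: card_edges_connected => // A AS A0 AnS; apply: contra conn => sep.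
  by apply/existsP; exists A; rewrite AS A0 AnS.
move: #|S| #|edges_in E S| dense => s e dense le_s.
(* If s <= K, a density above (K-1)/K forces e >= s; if s > K, the tree bound e >= s - 1 is
   enough. *)
case: K K_gt0 dense {IH} => // K _ /= dense.
by case: (leqP s K.+1) => ?; nia.
Qed.

End Density.

(** * Edge sets deleted from the complete graph *)

Section CompleteGraph.

Variable n : nat.
Implicit Types (S : {set 'I_n}) (F : {set {set 'I_n}}) (U : nat -> nat).

Let K := complete_graph 'I_n.

Lemma card_pairs (R : nat -> nat -> bool) :
  #|[set e : 'I_n * 'I_n | R e.1 e.2]| = \sum_(i < n) \sum_(j < n) R i j.
Proof.
rewrite pair_bigA /= -sum1_card big_mkcond; apply: eq_bigr => e _.
by rewrite inE; case: (R _ _).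
Qed.

Lemma card_eset_complete : #|eset K| = 'C(n, 2).
Proof. by rewrite /eset /= card_draws card_ord. Qed.

Definition deleted_pairs U : {set 'I_n * 'I_n} :=
  [set e : 'I_n * 'I_n | deleted n U e.1 e.2].

Definition deleted_edges U : {set {set 'I_n}} :=
  [set [set e.1; e.2] | e in deleted_pairs U].

Lemma deleted_edges_sub U : deleted_edges U \subset eset K.
Proof.
apply/subsetP => _ /imsetP[[i j] + ->]; rewrite !inE /= cards2.
case/and3P=> ltij _ _; suff -> : i != j by [].
by apply: contraTneq ltij => ->; rewrite ltnn.
Qed.

Lemma pair_set_inj (e f : 'I_n * 'I_n) : e.1 < e.2 -> f.1 < f.2 ->
  [set e.1; e.2] = [set f.1; f.2] -> e = f.
Proof.
case: e f => [i j] [k l] /= ltij ltkl eqs.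
have : i \in [set k; l] by rewrite -eqs !inE eqxx.
have : j \in [set k; l] by rewrite -eqs !inE eqxx orbT.
have : k \in [set i; j] by rewrite eqs !inE eqxx.
rewrite !inE => /orP[]/eqP ? /orP[]/eqP ? /orP[]/eqP ?; subst=> //; lia.
Qed.

Lemma deletion_word_lists U :
  lists_edges (deletion_word n U n) (deleted_edges U).
Proof.
pose s := [seq e <- [seq (i, j) | i <- enum 'I_n, j <- enum 'I_n]
             | deleted n U (nat_of_ord e.1) (nat_of_ord e.2)].
exists s; split.
  rewrite /s /deletion_word /mkseq -val_enum_ord -map_comp.
  elim: {1 3}(enum 'I_n) => //= i r IH.
  rewrite filter_cat map_cat flatten_cat -IH; congr (_ ++ _).
  rewrite /row_word /mkseq -val_enum_ord -map_comp.
  elim: (enum 'I_n) => //= j r' ->.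
  by case: ifP.
have us : uniq s.
  apply: filter_uniq; apply: allpairs_uniq; rewrite ?enum_uniq //.
  by move=> [i j] [k l].
apply: uniq_perm; first last.
- move=> e; rewrite mem_enum; apply/mapP/imsetP => [[f]|[f]].
    by rewrite mem_filter => /andP[df _] ->; exists f; rewrite ?inE.
  rewrite inE => df ->; exists f => //; rewrite mem_filter df.
  by apply/allpairsP; exists f; rewrite !mem_enum; case: f {df}.
- exact: enum_uniq.
rewrite map_inj_in_uniq // => e f.
rewrite !mem_filter => /andP[/and3P[lte _ _] _] /andP[/and3P[ltf _ _] _].
exact: pair_set_inj.
Qed.

Lemma card_deleted_edges U :
  #|deleted_edges U| + kept_in n U predT <= 'C(n, 2).
Proof.
have -> : 'C(n, 2) = \sum_(i < n) \sum_(j < n) [&& true, true & i < j].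
  by rewrite (sum_ord_pairs n predT) sum_ord_all.
apply: (@leq_trans (#|deleted_pairs U| + kept_in n U predT)).
  by rewrite leq_add2r leq_imset_card.
rewrite card_pairs -big_split; apply: leq_sum => i _ /=.
rewrite -big_split; apply: leq_sum => j _ /=.
by rewrite /deleted; lia.
Qed.

Definition nat_mem S : pred nat := fun i => i \in [seq nat_of_ord x | x in S].

Lemma nat_memE S (i : 'I_n) : nat_mem S i = (i \in S).
Proof. by rewrite /nat_mem mem_map ?mem_enum //; exact: ord_inj. Qed.

Lemma card_kept_edges U S :
  #|edges_in (eset (del_edges K (deleted_edges U))) S|
    <= kept_in n U (nat_mem S).
Proof.
rewrite /kept_in -(card_pairs (fun i j =>
  [&& nat_mem S i, nat_mem S j, i < j & ~~ deleted n U i j])).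
set P := [set e | _].
apply: leq_trans (leq_imset_card (fun e => [set e.1; e.2]) P).
apply/subset_leq_card/subsetP => e; rewrite !inE => /andP[/andP[eF e2] eS].
have {e2} /cards2P[x [y [xy eE]]] := e2; subst e.
wlog ltxy : x y xy eF eS / x < y.
  move=> W; case: (ltngtP x y) => [lt|lt|/ord_inj eqxy]; first exact: W.
    by rewrite setUC in eF eS *; apply: W; rewrite // eq_sym.
  by rewrite eqxy eqxx in xy.
have xS : x \in S by apply: (subsetP eS); rewrite !inE eqxx.
have yS : y \in S by apply: (subsetP eS); rewrite !inE eqxx orbT.
apply/imsetP; exists (x, y) => //; rewrite inE /= !nat_memE xS yS ltxy /=.
by apply: contra eF => df; apply/imsetP; exists (x, y); rewrite ?inE.
Qed.

Lemma deleted_edges_density p q : 0 < n -> 0 < q <= p.+1 ->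
  (max_density (del_edges K (deleted_edges (threshold n p q)))
     <= p%:R / q%:R)%R.
Proof.
move=> n_gt0 pq; apply/max_density_le; first by case/andP: pq.
move=> S _.
apply: (@leq_trans (q * kept_in n (threshold n p q) (nat_mem S))).
  by rewrite leq_mul2l card_kept_edges orbT.
apply: leq_trans (threshold_load _ n_gt0 pq) _.
rewrite leq_mul2l; apply/orP; right.
rewrite -sum1_card [leqRHS]big_mkcond; apply: leq_sum => i _.
by rewrite nat_memE; case: (i \in S).
Qed.

Lemma card_deleted_edges_threshold p q : 0 < n -> 0 < q ->
  #|deleted_edges (threshold n p q)| <= 'C(n, 2) - (n * p) %/ q.
Proof.
move=> n_gt0 q_gt0; have := card_deleted_edges (threshold n p q).
have := threshold_count p n_gt0 q_gt0.
by move: (_ %/ q) (kept_in _ _ _) => d k; lia.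
Qed.

Lemma card_del_edges F : F \subset eset K ->
  #|edges_in (eset (del_edges K F)) [set: 'I_n]| + #|F| = 'C(n, 2).
Proof.
move=> FK.
rewrite -card_eset_complete -(cardsID F (eset K)) (setIidPr FK) addnC.
by congr (_ + _); apply: eq_card => e; rewrite !inE subsetT andbT.
Qed.

End CompleteGraph.

(** * Optimality for both problems *)

Lemma max_density_ge0 (V : finType) (G : sgraph V) : (0 <= max_density G)%R.
Proof. exact: bigmax_ge_id. Qed.

Lemma max_density_ord0 (G : sgraph 'I_0) : max_density G = 0%R.
Proof.
apply/eqP; rewrite eq_le max_density_ge0 andbT.
apply/bigmax_leP; split=> // H _.
have /eqP v0 : #|vset H| == 0.
  by rewrite -leqn0 -[X in _ <= X](card_ord 0) max_card.
by rewrite /density v0 invr0 mulr0.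
Qed.

Lemma deleted_edges_ord0 U : #|deleted_edges 0 U| = 0.
Proof.
apply/eqP; rewrite -leqn0.
exact: leq_trans (leq_addr _ _) (card_deleted_edges 0 U).
Qed.

(** For p < q, (k-1)/k <= p/q rearranges to k(q - p) <= q, which holds for every k up to the
    rounded-down quotient. *)
Lemma round_to_tree_bounds n p q : 0 < n -> 0 < q ->
  let pq := round_to_tree n p q q (q - p) in
  0 < pq.2 <= pq.1.+1 /\ q * pq.1 <= p * pq.2.
Proof.
move=> n_gt0 q_gt0; rewrite /round_to_tree; case: eqP => [qp|/eqP qp] /=.
  by split; [lia | rewrite mulnC].
have d_gt0 : 0 < q - p by lia.
have := leq_trunc_div q (q - p).
have : 0 < q %/ (q - p) by rewrite divn_gt0 //; lia.
move: (q %/ _) => c c_gt0 le_c.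
have : minn n c * (q - p) <= q.
  by apply: leq_trans le_c; rewrite leq_mul2r geq_minr orbT.
have : 0 < minn n c by rewrite leq_min n_gt0.
by move: (minn n c) => k k_gt0 le_k; split; nia.
Qed.

Lemma bounded_density_optimal n p q : 0 < n -> 0 < q ->
  let pq := round_to_tree n p q q (q - p) in
  min_edge_deletion_bounded_density (complete_graph 'I_n) (p%:R / q%:R)%R
    (deleted_edges n (threshold n pq.1 pq.2)).
Proof.
move=> n_gt0 q_gt0 pq; have [pq2 le_pq] := round_to_tree_bounds p n_gt0 q_gt0.
rewrite -/pq in pq2 le_pq; have pq2_gt0 : 0 < pq.2 by case/andP: pq2.
split; first exact: deleted_edges_sub.
  apply: le_trans (deleted_edges_density n_gt0 pq2) _.
  by rewrite density_le // le_pq orbT.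
move=> F' F'K /(max_density_le _ _ q_gt0) loads.
apply: leq_trans (card_deleted_edges_threshold _ n_gt0 pq2_gt0) _.
rewrite -(card_del_edges F'K); set E := eset _.
have e_le : q * #|edges_in E [set: 'I_n]| <= p * n.
  by have := loads _ (subxx _); rewrite cardsT card_ord.
(* It remains to see that rounding p / q down costs no edge: a competitor obeys the rounded edge
   bound too. *)
suff : #|edges_in E [set: 'I_n]| <= (n * pq.1) %/ pq.2 by lia.
rewrite leq_divRL //; move: @pq pq2 le_pq pq2_gt0; rewrite /round_to_tree.
case: eqP => [qp _ _ _|/eqP qp] /=; first by rewrite mulnC [n * p]mulnC.
set c := q %/ (q - p); set K := minn n c => _ _ K_gt0.
rewrite mulnC [n * _]mulnC; case: (leqP n c) => [le_nc|lt_cn].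
  have -> : K = n by rewrite /K; lia.
  by move: #|edges_in _ _| e_le => e e_le; have lt_en : e < n; nia.
have KE : K = c by rewrite /K; lia.
rewrite leqNgt; apply/negP => dense.
have E2 e : e \in E -> #|e| = 2 by exact: eset_card2.
have [|A [_ A0 dA]] := dense_subset (S := [set: 'I_n]) E2 K_gt0.
  by rewrite cardsT card_ord.
(* By maximality of K, K/(K+1) > p/q, which contradicts the density of A. *)
have lt_q : q < K.+1 * (q - p) by rewrite KE /c -ltn_divLR // lt0n.
have := loads A (subsetT _); rewrite -card_gt0 in A0.
move: #|A| A0 dA => a a_gt0; rewrite -/E; move: #|_| => e dA le_e.
have lt_p : p * K.+1 < q * K by nia.
have h1 : q * (K * a) <= q * (K.+1 * e) by rewrite leq_mul2l dA orbT.
have h2 : K.+1 * (q * e) <= K.+1 * (p * a) by rewrite leq_mul2l le_e orbT.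
have h3 : p * K.+1 * a < q * K * a by rewrite ltn_pmul2r.
lia.
Qed.

(** With K = [pq.1] > 0, the last inequality reads (K-1)/K < m/n: the next smaller tree density has
    no room for m edges. *)
Lemma round_to_tree_budget n m : 0 < n ->
  let pq := round_to_tree n m n (n + (n - m) - 1) (n - m) in
  [/\ 0 < pq.2 <= pq.1.+1, m <= (n * pq.1) %/ pq.2 &
      pq = (m, n) \/ [/\ m < n, pq.1 = pq.2.-1 & pq.1 * (n - m) < n]].
Proof.
move=> n_gt0; rewrite /round_to_tree; case: eqP => [mn|/eqP mn] /=.
  by split; [lia | rewrite mulKn | left].
have d_gt0 : 0 < n - m by lia.
have := leq_trunc_div (n + (n - m) - 1) (n - m).
have := ltn_ceil (n + (n - m) - 1) d_gt0.
move: (_ %/ _) => c lt_c le_c.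
have c_gt0 : 0 < c by case: c lt_c {le_c} => //; lia.
have le_cn : c <= n by nia.
rewrite (minn_idPr le_cn); split; first by lia.
  by rewrite leq_divRL //; case: c lt_c le_c c_gt0 le_cn => // c; nia.
by right; split; [lia | | case: c lt_c le_c c_gt0 le_cn => // c; nia].
Qed.

Lemma density_optimal n k : 0 < n ->
  let m := 'C(n, 2) - k in
  let pq := round_to_tree n m n (n + (n - m) - 1) (n - m) in
  min_density_edge_deletion (complete_graph 'I_n) k
    (deleted_edges n (threshold n pq.1 pq.2)).
Proof.
move=> n_gt0 m pq; have [pq2 le_m pqE] := round_to_tree_budget m n_gt0.
rewrite -/pq in pq2 le_m pqE; have pq2_gt0 : 0 < pq.2 by case/andP: pq2.
split; first exact: deleted_edges_sub.
  apply: leq_trans (card_deleted_edges_threshold _ n_gt0 pq2_gt0) _.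
  by rewrite /m in le_m *; lia.
move=> F' F'K F'k; apply: le_trans (deleted_edges_density n_gt0 pq2) _.
have := card_del_edges F'K; set G := del_edges _ F'.
set e := #|_| => eE; have le_me : m <= e by rewrite /m; lia.
have vG (A : {set 'I_n}) : A \subset vset G by exact: subsetT.
case: pqE => [->|[lt_mn pq1E lt_n]] /=.
  apply: le_trans (density_le_max (vG [set: 'I_n])).
  by rewrite cardsT card_ord density_le // mulnC leq_mul2r le_me !orbT.
(* Target density 0 is trivially optimal. Otherwise a competitor, with density at least m/n >
   (K-1)/K for K = [pq.1], has a subset A of density at least K/(K+1), the target. *)
case: (posnP pq.1) => [->|pq1_gt0]; first by rewrite mul0r max_density_ge0.
have [||A [_ A0 dA]] :=
    dense_subset (S := [set: 'I_n]) (K := pq.1) (@eset_card2 _ G) => //.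
  by rewrite cardsT card_ord -/e; nia.
apply: le_trans (density_le_max (vG A)).
rewrite density_le ?card_gt0 //; apply/orP; right.
by rewrite mulnC (leq_trans dA) // pq1E prednK // mulnC.
Qed.

(** * Both problems on the machine *)

Lemma bigO_square a b : bigO (fun n => a * n ^ 2 + b) (fun n => n ^ 2).
Proof. by exists (a + b), 1 => n n_gt0; nia. Qed.

Lemma rat_of_word (tau : rat) : (0 <= tau)%R ->
  tau = (`|numq tau|%:R / `|denq tau|%:R)%R.
Proof.
move=> tau_ge0; rewrite -[LHS]divq_num_den !natr_absz.
by rewrite !ger0_norm ?numq_ge0 // ltW // denq_gt0.
Qed.

Theorem theorem8 :
  solvable_in_time rat_word
    (fun (n : nat) (G : sgraph 'I_n) (tau : rat) =>
       G = complete_graph 'I_n /\ (0 <= tau)%R)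
    (fun (n : nat) (G : sgraph 'I_n) (tau : rat) (F : {set {set 'I_n}}) =>
       min_edge_deletion_bounded_density G tau F)
    (fun n : nat => n ^ 2)
  /\
  solvable_in_time (fun k : nat => [:: k])
    (fun (n : nat) (G : sgraph 'I_n) (_ : nat) => G = complete_graph 'I_n)
    (fun (n : nat) (G : sgraph 'I_n) (k : nat) (F : {set {set 'I_n}}) =>
       min_density_edge_deletion G k F)
    (fun n : nat => n ^ 2).
Proof.
split.
  (* The constant 9 pays for the run with n = 0. *)
  exists (bounded_density_code 0), (fun n => 500 * n ^ 2 + 9).
  split=> [|n _ tau [-> tau_ge0]]; first exact: bigO_square.
  rewrite /instance_word /rat_word /=.
  set p := `|numq tau|; set q := `|denq tau|; set w := adjacency_word _.
  have q_gt0 : 0 < q by rewrite absz_gt0 denq_neq0.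
  have tauE := rat_of_word tau_ge0; rewrite -/p -/q in tauE.
  case: (posnP n) @w => [->|n_gt0] w.
    have [X [inp [out [run outE]]]] :=
      triple_computes (@triple_bounded_density0 [:: p, q & w])
        (And3 erefl erefl erefl).
    (* Without vertices every table gives the empty set; [id] is an arbitrary one. *)
    exists [::], (deleted_edges 0 id); split.
      by rewrite -[X in computes_within _ _ _ X]outE.
      exact: (deletion_word_lists 0 id).
    split; first exact: deleted_edges_sub.
      by rewrite max_density_ord0.
    by rewrite deleted_edges_ord0.
  have [/andP[pq2 _] _] := round_to_tree_bounds p n_gt0 q_gt0.
  have [X [inp [out [run outE]]]] :=
    triple_computes (triple_conseq (triple_bounded_density (w := w) n_gt0 pq2)
      (leq_addr 9 _) (fun X inp out H => H) (fun X inp out H => H))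
      (And3 erefl erefl erefl).
  exists out; eexists; split; first exact: run.
    by rewrite outE; exact: deletion_word_lists.
  by rewrite tauE; exact: bounded_density_optimal.
exists (density_code 0), (fun n => 500 * n ^ 2 + 9).
split=> [|n _ k ->]; first exact: bigO_square.
rewrite /instance_word /=; set w := adjacency_word _.
case: (posnP n) @w => [->|n_gt0] w.
  have [X [inp [out [run outE]]]] :=
    triple_computes (triple_conseq (@triple_density0 (k :: w)) (t' := 9)
      isT (fun X inp out H => H) (fun X inp out H => H))
      (And3 erefl erefl erefl).
  exists [::], (deleted_edges 0 id); split.
    by rewrite -[X in computes_within _ _ _ X]outE.
    exact: (deletion_word_lists 0 id).
  split; [exact: deleted_edges_sub | by rewrite deleted_edges_ord0 |].
  by move=> F' _ _; rewrite !max_density_ord0.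
have [/andP[pq2 _] _ _] := round_to_tree_budget ('C(n, 2) - k) n_gt0.
have [X [inp [out [run outE]]]] :=
  triple_computes (triple_conseq (triple_density (w := w) n_gt0 pq2)
    (leq_addr 9 _) (fun X inp out H => H) (fun X inp out H => H))
    (And3 erefl erefl erefl).
exists out; eexists; split; first exact: run.
  by rewrite outE; exact: deletion_word_lists.
exact: density_optimal.
Qed.
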